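(* Suppose that for every stream $s$, $\mathcal{F}\,\mathit{red}\,s\ \vee\ \mathcal{G}\,\mathit{blue}\,s$ (this is LPO). Then for every stream $s$, if the set $\mathcal{R}_s$ of red positions of $s$ is streamless, then $\mu\mathcal{W}\,s$.
   Context: The statement is to be proved constructively (intuitionistic type theory with inductive and coinductive definitions; no excluded middle, no Markov's principle, other than the stated hypothesis). A color is one of $R$ (red), $B$ (blue). A stream is an element of the coinductive type whose only constructor forms $c\,s$ from a color $c$ and a stream $s$; streams are considered up to bisimilarity (equivalently, functions $\mathbb{N}\to\{R,B\}$ up to pointwise equality). $s@n$ denotes the color of $s$ at position $n$ (positions start at $0$). $\mathit{red}\,s$ means $s=R\,s'$ for some $s'$; $\mathit{blue}\,s$ means $s=B\,s'$ for some $s'$. For a stream predicate $X$: $\mathcal{F}\,X$ is defined inductively by the rules: $X\,s$ implies $\mathcal{F}\,X\,s$; $\mathcal{F}\,X\,s$ implies $\mathcal{F}\,X\,(c\,s)$ for any color $c$. $\mathcal{G}\,X$ is defined coinductively by the rule: $X\,(c\,s)$ and $\mathcal{G}\,X\,s$ imply $\mathcal{G}\,X\,(c\,s)$. $\mathcal{R}_s=\{n\in\mathbb{N}\mid s@n=R\}$. For a set $A$, the duplicate-free colists $\mathit{colist}\,A$ over $A$ are defined coinductively: $\langle\rangle:\mathit{colist}\,A$; and if $x\in A$ and $\ell:\mathit{colist}\,(A\setminus\{x\})$ then $x\,\ell:\mathit{colist}\,A$. Finiteness $\ell\downarrow$ is defined inductively: $\langle\rangle\downarrow$; and $\ell\downarrow$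 implies $(x\,\ell)\downarrow$. $A$ is streamless if $\ell\downarrow$ for every $\ell:\mathit{colist}\,A$. For a stream predicate $X$, the weak until predicate $\mathcal{W}_X$ is defined coinductively by the rules: $\mathcal{W}_X\,s$ implies $\mathcal{W}_X\,(B\,s)$; $X\,s$ implies $\mathcal{W}_X\,(R\,s)$. The operator $X\mapsto\mathcal{W}_X$ is monotone, and $\mu\mathcal{W}$ is its least fixed point, i.e. the predicate defined inductively by the rule: $\mathcal{W}_{\mu\mathcal{W}}\,s$ implies $\mu\mathcal{W}\,s$ (equivalently, Mendler-style: if $X$ is a stream predicate with $\forall s'.\,X\,s'\Rightarrow\mu\mathcal{W}\,s'$ and $\mathcal{W}_X\,s$, then $\mu\mathcal{W}\,s$). *)

(* Defs.v *)
From Stdlib Require Export Streams.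

Set Implicit Arguments.

(* Propositions are read as types: predicates are [Type]-valued and disjunction
   is [sum], since [Prop] would not allow the disjunction given by LPO to be
   used in building a colist.  This is why [Exists] and [ForAll] of [Streams]
   are not used for [F] and [G].

   Streams are compared by Leibniz equality only to expose the head
   constructor, where nothing is lost: [s = Cons (hd s) (tl s)] always holds.
   The predicates used below are invariant under [EqSt]. *)

Inductive color : Set := Red | Blue.

Notation stream := (Stream color).

Definition red (s : stream) : Type := {s' : stream | s = Cons Red s'}.

Definition blue (s : stream) : Type := {s' : stream | s = Cons Blue s'}.

Inductive F (X : stream -> Type) : stream -> Type :=
| F_here s : X s -> F X s
| F_later c s : F X s -> F X (Cons c s).

CoInductive G (X : stream -> Type) : stream -> Type :=
| G_cons c s : X (Cons c s) -> G X s -> G X (Cons c s).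

(* Sets are represented as subsets of an ambient type [T]. *)

Definition remove (T : Type) (A : T -> Type) (x : T) : T -> Type :=
  fun y => (A y * (y <> x))%type.

CoInductive colist (T : Type) (A : T -> Type) : Type :=
| conil : colist A
| cocons (x : T) : A x -> colist (remove A x) -> colist A.

Arguments conil {T A}.

Inductive finite (T : Type) (A : T -> Type) : colist A -> Type :=
| finite_nil : finite conil
| finite_cons (x : T) (Ax : A x) (l : colist (remove A x)) :
    finite l -> finite (cocons Ax l).

Definition streamless (T : Type) (A : T -> Type) : Type :=
  forall l : colist A, finite l.

Definition red_positions (s : stream) : nat -> Type :=
  fun n => Str_nth n s = Red.

CoInductive W (X : stream -> Type) : stream -> Type :=
| W_blue s : W X s -> W X (Cons Blue s)
| W_red s : X s -> W X (Cons Red s).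

(* Mendler style: the direct rule [W muW s -> muW s] nests an inductive inside a
   coinductive type, and Rocq's guard condition then blocks recursion on [muW].
   The lemmas [muW_fold] and [muW_least] show that this is the least fixed
   point of [W]. *)
Inductive muW : stream -> Type :=
| muW_intro (X : stream -> Type) s :
    (forall s', X s' -> muW s') -> W X s -> muW s.

CoFixpoint W_mono (X Y : stream -> Type) (f : forall s, X s -> Y s) s
    (w : W X s) : W Y s :=
  match w with
  | W_blue w' => W_blue (@W_mono X Y f _ w')
  | W_red _ _ x => @W_red Y _ (f _ x)
  end.

Lemma muW_least (X : stream -> Type) :
  (forall s, W X s -> X s) -> forall s, muW s -> X s.
Proof.
intros closed s m; induction m as [Y s _ IH w].
exact (closed s (@W_mono Y X IH s w)).
Qed.

(* [muW_intro] cannot be used with [X := muW], for universe reasons, but it can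
   with the predicate of being the part of [s] after its first red. *)
Fixpoint after_red (n : nat) (s : stream) : option stream :=
  match n, s with
  | O, Cons Red s' => Some s'
  | S n', Cons Blue s' => after_red n' s'
  | _, _ => None
  end.

Lemma W_after_red (X : stream -> Type) n :
  forall s s', after_red n s = Some s' -> W X s -> X s'.
Proof.
induction n as [|n IH]; intros s s' e w; destruct w as [s w|s x];
  simpl in e; try discriminate.
- injection e as <-; exact x.
- exact (IH s s' e w).
Qed.

Lemma after_red_W (X Y : stream -> Type) :
  forall s, (forall n s', after_red n s = Some s' -> Y s') -> W X s -> W Y s.
Proof.
cofix IH; intros s y w; destruct w as [s w|s x]; constructor.
- exact (IH s (fun n => y (S n)) w).
- exact (y O s eq_refl).
Qed.

Lemma muW_fold s : W muW s -> muW s.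
Proof.
intro w; apply (@muW_intro (fun s' => {n : nat | after_red n s = Some s'})).
- intros s' [n e]; exact (W_after_red n e w).
- refine (after_red_W _ _ w); intros n s' e; exists n; exact e.
Qed.

(* Main.v *)
(* LPO finds the first red of a stream or shows that there is none, so iterating
   it lists the red positions of [s] in increasing order.  Since [red_positions s]
   is streamless this list is finite, and induction on its finiteness builds
   [muW] of the part of [s] from which each tail of the list was computed. *)
Require Import Defs.
From Stdlib Require Import Lia PeanoNat Eqdep_dec.

(** A derivation of [F red t] may pass over a red to reach a later one; resetting the index to 0 at
    each [Red] head yields the first. *)
Lemma F_first_red t :
  F red t -> {k : nat | after_red k t = Some (Str_nth_tl (S k) t)}.
Proof.
induction 1 as [t [t' ->]|[|] t _ [k e]].
- exists 0; reflexivity.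
- exists 0; reflexivity.
- exists (S k); exact e.
Defined.

Lemma after_red_nth k :
  forall t t', after_red k t = Some t' -> Str_nth k t = Red.
Proof.
induction k as [|k IH]; intros [[|] t] t' e; try discriminate.
- reflexivity.
- exact (IH t t' e).
Qed.

Lemma G_blue_W (X : stream -> Type) : forall t, G blue t -> W X t.
Proof.
cofix IH; intros t [c u [u' e] g]; destruct c.
- discriminate.
- exact (W_blue (IH u g)).
Qed.

Lemma W_of_after_red (X : stream -> Type) k :
  forall t t', after_red k t = Some t' -> X t' -> W X t.
Proof.
induction k as [|k IH]; intros [[|] t] t' e x; try discriminate.
- injection e as ->; exact (W_red X _ x).
- exact (W_blue (IH t t' e x)).
Qed.

(** Invariant of the listing: [A] may have lost positions already listed, all below [n], but still
    holds every red one from [n] on. *)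
Definition red_from_in (s : stream) (n : nat) (A : nat -> Type) : Type :=
  forall m, n <= m -> Str_nth m s = Red -> A m.

Lemma red_from_in_here s n k t A :
  red_from_in s n A -> after_red k (Str_nth_tl n s) = Some t -> A (k + n).
Proof.
intros h e; apply h; [lia|].
rewrite <- Str_nth_plus; exact (after_red_nth _ _ _ e).
Qed.

Lemma red_from_in_remove s n k A :
  red_from_in s n A -> red_from_in s (S k + n) (remove A (k + n)).
Proof.
intros h m le r; split; [apply h; [lia|exact r]|lia].
Qed.

CoFixpoint list_red (lpo : forall s, (F red s + G blue s)%type)
    (s : stream) (n : nat) (A : nat -> Type) (h : red_from_in s n A) : colist A :=
  match lpo (Str_nth_tl n s) with
  | inl f =>
      let (k, e) := F_first_red _ f in
      cocons (red_from_in_here _ _ _ _ _ h e)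
        (list_red lpo s _ _ (red_from_in_remove s n k A h))
  | inr _ => conil
  end.

Lemma colist_eta (T : Type) (A : T -> Type) (l : colist A) :
  l = match l with conil => conil | cocons a l' => cocons a l' end.
Proof. destruct l; reflexivity. Qed.

(** The type of the tail depends on [x], so injectivity gives an equality of dependent pairs;
    decidable equality on [nat] strips it without axioms. *)
Lemma cocons_inj (A : nat -> Type) x (a b : A x) (l l' : colist (remove A x)) :
  cocons a l = cocons b l' -> l = l'.
Proof.
intro e; injection e as _ e.
exact (inj_pair2_eq_dec _ Nat.eq_dec _ _ _ _ e).
Qed.

Lemma finite_list_red_muW lpo s (A : nat -> Type) (l : colist A) :
  finite l ->
  forall n (h : red_from_in s n A), l = list_red lpo s n A h ->
  muW (Str_nth_tl n s).
Proof.
induction 1 as [A|A x a l _ IH]; intros n h e;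
  rewrite (colist_eta _ _ (list_red _ _ _ _ _)) in e; simpl in e;
  destruct (lpo (Str_nth_tl n s)) as [f|g];
  (* With no red left, [W] holds whatever the list is; an empty list with a red found is
     contradictory. *)
  try exact (muW_fold (G_blue_W _ _ g));
  destruct (F_first_red _ f) as [k r]; try discriminate.
assert (x = k + n) as -> by (injection e; auto).
apply cocons_inj in e.
apply muW_fold, (W_of_after_red _ _ _ _ r).
(* What follows the first red is the suffix of [s] at [S k + n], where the tail of the list was
   computed. *)
rewrite Str_nth_tl_plus.
exact (IH _ _ e).
Qed.

Theorem lemma4p9 :
  (forall s : stream, F red s + G blue s) ->
  forall s : stream, streamless (red_positions s) -> muW s.
Proof.
intros lpo s fin.
assert (h : red_from_in s 0 (red_positions s)) by (intros m _ r; exact r).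
exact (finite_list_red_muW lpo s _ _ (fin (list_red lpo s 0 _ h)) 0 h eq_refl).
Qed.
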